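(* Let $n\ge 2$, let $(s_1,\dots,s_{n-1},s_n)\in\Gamma_n$, and let $\tau$ be an automorphism of $\mathbb G_n$, so that $\tau=\tau_m$ with $m(z)=\beta\frac{z-a}{1-\bar az}$ for some $a\in\mathbb D$ and $\beta\in\mathbb T$. Then $\tau(s_1,\dots,s_{n-1},s_n)=(s_{1\tau},\dots,s_{(n-1)\tau},s_{n\tau})$, where for each $i=1,\dots,n$ $$s_{i\tau}=\beta^i\,\frac{\displaystyle\sum_{j=1}^{i-1}(-a)^{i-j}\Big[\sum_{k=0}^{j}\binom{n-j}{i-j+k}\binom{j}{k}|a|^{2k}\Big]s_j+\sum_{j=i}^{n}(-\bar a)^{j-i}\Big[\sum_{k=0}^{i}\binom{j}{i-k}\binom{n-j}{k}|a|^{2k}\Big]s_j+(-1)^i\binom{n}{i}a^i}{\displaystyle 1+\sum_{l=1}^{n}(-1)^l\bar a^{\,l}s_l}.$$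
   Context: $\mathbb D$ is the open unit disc in $\mathbb C$ and $\mathbb T$ the unit circle. Let $\pi_n:\mathbb C^n\to\mathbb C^n$ be the symmetrization map $\pi_n(z_1,\dots,z_n)=\big(\sum_{i}z_i,\sum_{i<j}z_iz_j,\dots,\prod_i z_i\big)$, whose $i$-th component is the $i$-th elementary symmetric polynomial. The open and closed symmetrized polydisc are $\mathbb G_n=\pi_n(\mathbb D^n)$ and $\Gamma_n=\pi_n(\overline{\mathbb D}^n)$. An automorphism of a domain is a biholomorphic self-map. It is known that every automorphism of $\mathbb G_n$ is of the form $\tau_m$, where $\tau_m(\pi_n(z_1,\dots,z_n))=\pi_n(m(z_1),\dots,m(z_n))$ and $m$ is an automorphism of $\mathbb D$, i.e. $m(z)=\beta\frac{z-a}{1-\bar az}$ with $a\in\mathbb D$, $\beta\in\mathbb T$. The map $\tau_m$ extends to $\Gamma_n$ by the same formula with $z_1,\dots,z_n\in\overline{\mathbb D}$. Convention: $\binom{p}{q}=0$ if $q>p$ or $q<0$. *)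

(* Defs.v *)
From HB Require Import structures.
From mathcomp Require Import all_boot all_order all_algebra.
From mathcomp Require Import complex.
From mathcomp Require Import all_classical all_reals all_analysis.

Set Implicit Arguments.
Unset Strict Implicit.
Unset Printing Implicit Defensive.

Import Order.TTheory GRing.Theory Num.Theory.
Import numFieldNormedType.Exports.

Local Open Scope classical_set_scope.
Local Open Scope ring_scope.

(* The ascription gives C^n = 'rV[Cplx R]_n its normed C-module structure. *)
Definition Cplx (R : realType) : numClosedFieldType := R[i].

Definition disc (R : realType) : set (Cplx R) := [set z | `|z| < 1].

Definition closed_disc (R : realType) : set (Cplx R) := [set z | `|z| <= 1].

Definition circle (R : realType) : set (Cplx R) := [set z | `|z| = 1].

Definition polydisc (R : realType) (n : nat) : set 'rV[Cplx R]_n :=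
  [set z | forall l, disc (z 0 l)].

Definition closed_polydisc (R : realType) (n : nat) : set 'rV[Cplx R]_n :=
  [set z | forall l, closed_disc (z 0 l)].

Definition elem_sym (R : realType) (n : nat) (z : 'rV[Cplx R]_n) (k : nat) :
    Cplx R :=
  \sum_(A : {set 'I_n} | #|A| == k) \prod_(l in A) z 0 l.

Definition symmetrization (R : realType) (n : nat) (z : 'rV[Cplx R]_n) :
    'rV[Cplx R]_n :=
  \row_(k < n) elem_sym z k.+1.

(* The symmetrized polydiscs G_n and Gamma_n. *)
Definition sym_polydisc (R : realType) (n : nat) : set 'rV[Cplx R]_n :=
  @symmetrization R n @` @polydisc R n.

Definition closed_sym_polydisc (R : realType) (n : nat) : set 'rV[Cplx R]_n :=
  @symmetrization R n @` @closed_polydisc R n.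

(* Differentiability is over the scalar field C, i.e. complex
   differentiability; it is meant for an open set D. *)
Definition holomorphic_on (R : realType) (n : nat) (D : set 'rV[Cplx R]_n)
    (f : 'rV[Cplx R]_n -> 'rV[Cplx R]_n) : Prop :=
  forall x, D x -> differentiable f x.

(* Only the values of f on D matter (D open). *)
Definition automorphism (R : realType) (n : nat) (D : set 'rV[Cplx R]_n)
    (f : 'rV[Cplx R]_n -> 'rV[Cplx R]_n) : Prop :=
  set_bij D D f /\ holomorphic_on D f /\
  exists g : 'rV[Cplx R]_n -> 'rV[Cplx R]_n,
    [/\ forall x, D x -> D (g x),
        forall x, D x -> g (f x) = x,
        forall x, D x -> f (g x) = x
      & holomorphic_on D g].

Definition disc_aut (R : realType) (a beta : Cplx R) (z : Cplx R) : Cplx R :=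
  beta * ((z - a) / (1 - a^* * z)).

(* tau restricts to tau_m on Gamma_n (hence on its subset G_n). *)
Definition is_tau (R : realType) (n : nat) (m : Cplx R -> Cplx R)
    (tau : 'rV[Cplx R]_n -> 'rV[Cplx R]_n) : Prop :=
  forall z, closed_polydisc z ->
    tau (symmetrization z) = symmetrization (map_mx m z).

(* Coordinates numbered from 1: coord1 s j = s_j for 1 <= j <= n. *)
Definition coord1 (R : realType) (n : nat) (s : 'rV[Cplx R]_n) (j : nat) :
    Cplx R :=
  if (insub j.-1 : option 'I_n) is Some k then s 0 k else 0.

(* Main.v *)
Require Import Defs.
From HB Require Import structures.
From mathcomp Require Import all_boot all_order all_algebra.
From mathcomp Require Import complex.
From mathcomp Require Import all_classical all_reals all_analysis.
From mathcomp Require Import ring.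

Set Implicit Arguments.
Unset Strict Implicit.
Unset Printing Implicit Defensive.

Import Order.TTheory GRing.Theory Num.Theory.
Import numFieldNormedType.Exports.

Local Open Scope classical_set_scope.
Local Open Scope ring_scope.

(** Write [s] as the symmetrization of [z] and put [b := a^*].  The elementary
    symmetric polynomials of the points [w_l := (z_l - a) / (1 - b z_l)] are
    the coefficients of [\prod_l (1 + X w_l)].  Clearing denominators,
    [[
      \prod_l (1 - b z_l) * \prod_l (1 + X w_l)
        = \prod_l ((1 - a X) + (X - b) z_l),
    ]]
    and the right-hand side is again a product of affine functions of the
    [z_l], so that it equals [\sum_j (1 - a X)^(n - j) (X - b)^j e_j(z)].  Thus
    a single expansion ([prod_addM_esym]) serves three times: over the
    polynomials with the [w_l], over the polynomials with the [z_l], and over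
    the scalars, where it identifies the denominator of the theorem with
    [\prod_l (1 - b z_l)].  Comparing coefficients of [X^i] gives
    [esym_moebius], an identity valid over any field.

    The coefficient of [e_j(z)] found in this way is a convolution of two
    binomial expansions.  Pairing powers of [a] and of [a^*] turns it into a
    power of [-a] (when [j < i]) or of [-a^*] (when [i <= j]) times a sum of
    powers of [a a^* = |a|^2]: these are [convolution_lt] and
    [convolution_ge], and the term [j = 0] is the summand without [s_j].  The
    factor [beta] only contributes [beta^i] by homogeneity. *)

(** Stated over any commutative ring because it is needed both for complex
    numbers and for constant polynomials; at [Cplx R] it unfolds to [elem_sym]. *)
Definition esym (F : comNzRingType) (I : finType) (z : I -> F) (k : nat) : F :=
  \sum_(A : {set I} | #|A| == k) \prod_(l in A) z l.

Lemma esym0 (F : comNzRingType) (I : finType) (z : I -> F) : esym z 0 = 1.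
Proof.
rewrite /esym (big_pred1 finset.set0) ?big_set0 // => A.
by rewrite cards_eq0.
Qed.

Lemma esymZ (F : comNzRingType) (I : finType) (c : F) (z : I -> F) k :
  esym (fun l => c * z l) k = c ^+ k * esym z k.
Proof.
rewrite /esym mulr_sumr; apply: eq_bigr => A /eqP <-.
by rewrite big_split /= prodr_const.
Qed.

Lemma esym_rmorph (F G : comNzRingType) (f : {rmorphism F -> G}) (I : finType)
    (z : I -> F) k :
  esym (fun l => f (z l)) k = f (esym z k).
Proof.
by rewrite /esym rmorph_sum; apply: eq_bigr => A _; rewrite rmorph_prod.
Qed.

(** Choosing the second summand on the index set [A] and the first one
    elsewhere contributes [v ^+ #|A| * u ^+ #|~: A|]; subsets are then grouped
    by size. *)
Lemma prod_addM_esym (F : comNzRingType) (I : finType) (u v : F) (z : I -> F) :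
  \prod_l (u + v * z l) =
  \sum_(j < #|I|.+1) u ^+ (#|I| - j) * v ^+ j * esym z j.
Proof.
under eq_bigr do rewrite addrC.
rewrite bigA_distr.
rewrite (partition_big (fun A : {set I} => inord #|A| : 'I_#|I|.+1) xpredT) //=.
apply: eq_bigr => j _; rewrite /esym mulr_sumr.
apply: eq_big => [A|A /eqP Aj].
  by rewrite -val_eqE /= inordK // ltnS max_card.
have cardA : #|A| = j by rewrite -Aj inordK // ltnS max_card.
rewrite (bigID (mem A)) /= mulrC.
rewrite [in X in X * _](eq_bigr (fun=> u)) => [|l /negbTE ->//].
rewrite [in X in _ * X](eq_bigr (fun l => v * z l)) => [|l ->//].
rewrite big_split /= !prodr_const mulrA cardA.
congr (_ ^+ _ * _ * _).
by rewrite -cardA -(cardC A) addKn; apply: eq_card => x; rewrite !inE.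
Qed.

Lemma coef_addCZX_exp (F : comNzRingType) (c d : F) m k :
  ((c%:P + d *: 'X) ^+ m)`_k = c ^+ (m - k) * d ^+ k * 'C(m, k)%:R.
Proof.
rewrite mulr_natr exprDn coef_sum.
under eq_bigr => i _.
  rewrite coefMn exprZn -rmorphXn coefCM coefZ coefXn.
  over.
have [km|mk] := leqP k m.
  rewrite (bigD1 (Ordinal (km : (k < m.+1)%N))) //= eqxx mulr1 big1 ?addr0 //.
  move=> i; rewrite -val_eqE /= eq_sym => /negbTE ->.
  by rewrite !mulr0 mul0rn.
rewrite bin_small // mulr0n big1 // => i _.
by rewrite gtn_eqF ?mulr0 ?mul0rn // (leq_trans _ mk) // ltn_ord.
Qed.

(** Vieta's formulas for the reciprocal polynomial, so that the index of the
    coefficient is the degree of the symmetric function. *)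
Lemma coef_prod_addMX (F : comNzRingType) (I : finType) (w : I -> F) i :
  (i <= #|I|)%N -> (\prod_l (1 + 'X * (w l)%:P))`_i = esym w i.
Proof.
move=> le_i; rewrite prod_addM_esym coef_sum.
under eq_bigr do rewrite expr1n mul1r (esym_rmorph (@polyC F)) coefMC coefXn.
rewrite (bigD1 (Ordinal (le_i : (i < #|I|.+1)%N))) //= eqxx mul1r.
rewrite big1 ?addr0 // => j.
by rewrite -val_eqE /= eq_sym => /negbTE ->; rewrite mul0r.
Qed.

(** The parameter [b] stands for the conjugate of [a], but the identity is
    purely algebraic in [a] and [b]. *)
Lemma esym_moebius (F : fieldType) (I : finType) (a b : F) (z : I -> F) i :
  (forall l, 1 - b * z l != 0) -> (i <= #|I|)%N ->
  esym (fun l => (z l - a) / (1 - b * z l)) i * \prod_l (1 - b * z l) =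
  \sum_(j < #|I|.+1)
    (\sum_(k < i.+1) (- b) ^+ (j - (i - k)) * (- a) ^+ k
        * ('C(j, i - k) * 'C(#|I| - j, k))%:R) * esym z j.
Proof.
move=> den_neq0 le_i.
pose w l := (z l - a) / (1 - b * z l).
have prod_eq : \prod_l (1 + 'X * (w l)%:P) * (\prod_l (1 - b * z l))%:P =
    \prod_l ((1%:P + (- a) *: 'X) + ((- b)%:P + 1 *: 'X) * (z l)%:P).
  rewrite rmorph_prod -big_split; apply: eq_bigr => l _ /=.
  have wE : (w l)%:P * (1 - b * z l)%:P = (z l - a)%:P.
    by rewrite -polyCM divfK.
  rewrite mulrDl mul1r -mulrA wE -!mul_polyC !polyCN !polyCB polyCM !polyC1.
  ring.
rewrite -(coef_prod_addMX w le_i) -coefMC prod_eq prod_addM_esym coef_sum.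
apply: eq_bigr => j _.
rewrite (esym_rmorph (@polyC F)) coefMC coefM; congr (_ * _).
apply: eq_bigr => k _.
rewrite !coef_addCZX_exp !expr1n mul1r mulr1.
by rewrite natrM; ring.
Qed.

(** When [k < i - j] the first binomial coefficient has [i - k > j] and
    vanishes; the other terms are reindexed by [k - (i - j)]. *)
Lemma convolution_lt (F : comNzRingType) (a b : F) (n j i : nat) :
  (j < i)%N ->
  \sum_(k < i.+1) (- b) ^+ (j - (i - k)) * (- a) ^+ k
      * ('C(j, i - k) * 'C(n - j, k))%:R =
  (- a) ^+ (i - j) *
  \sum_(0 <= k < j.+1)
     'C(n - j, i - j + k)%:R * 'C(j, k)%:R * (a * b) ^+ k.
Proof.
move=> lt_ji; have le_ji := ltnW lt_ji.
rewrite -(big_mkord xpredT (fun k => (- b) ^+ (j - (i - k)) * (- a) ^+ k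
  * ('C(j, i - k) * 'C(n - j, k))%:R)).
rewrite (@big_cat_nat _ _ _ (i - j)) //=; last first.
  by rewrite (leq_trans (leq_subr _ _)).
rewrite big_nat big1 ?add0r; last first.
  by move=> k /= lt_k; rewrite bin_small ?mulr0 // ltn_subCr.
rewrite -{1}[(i - j)%N]add0n big_addn subSn ?leq_subr // subKn //.
rewrite mulr_sumr; apply: eq_big_nat => k /= lt_k.
have le_kj : (k <= j)%N by [].
have -> : (i - (k + (i - j)) = j - k)%N by rewrite addnC subnDA subKn.
rewrite subKn // bin_sub // natrM addnC !exprD.
rewrite -[a * b]mulrNN exprMn.
ring.
Qed.

(** As [i - k <= j], the exponent of [- b] equals [(j - i) + k]; its part [k]
    pairs with [(- a) ^+ k] into [(a * b) ^+ k]. *)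
Lemma convolution_ge (F : comNzRingType) (a b : F) (n j i : nat) :
  (i <= j)%N ->
  \sum_(k < i.+1) (- b) ^+ (j - (i - k)) * (- a) ^+ k
      * ('C(j, i - k) * 'C(n - j, k))%:R =
  (- b) ^+ (j - i) *
  \sum_(0 <= k < i.+1)
     'C(j, i - k)%:R * 'C(n - j, k)%:R * (a * b) ^+ k.
Proof.
move=> le_ij; rewrite big_mkord mulr_sumr; apply: eq_bigr => k _.
have le_ki : (k <= i)%N by rewrite -ltnS.
have -> : (j - (i - k) = j - i + k)%N by rewrite subnBA // addnBAC.
rewrite natrM exprD -[a * b]mulrNN exprMn.
ring.
Qed.

Lemma coord1_symmetrization (R : realType) (n : nat) (z : 'rV[Cplx R]_n) j :
  (1 <= j <= n)%N -> coord1 (symmetrization z) j = esym (z 0) j.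
Proof.
case: j => // j lt_jn; rewrite /coord1 /=.
by rewrite insubT mxE.
Qed.

(** This makes [disc_aut a beta] regular on the closed disc, boundary included. *)
Lemma one_sub_conjM_neq0 (R : realType) (a z : Cplx R) :
  disc a -> closed_disc z -> 1 - a^* * z != 0.
Proof.
rewrite /disc /closed_disc /= => lt_a le_z; rewrite subr_eq0.
apply/eqP => /(congr1 Num.norm); rewrite normr1 normrM norm_conjC => eq1.
suff : `|a| * `|z| < 1 by rewrite -eq1 ltxx.
by rewrite (le_lt_trans _ lt_a) // ler_piMr.
Qed.

Theorem lemma2p1 (R : realType) (n : nat) (n_ge2 : (2 <= n)%N)
    (s : 'rV[Cplx R]_n) (s_Gamma : closed_sym_polydisc s)
    (tau : 'rV[Cplx R]_n -> 'rV[Cplx R]_n)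
    (tau_aut : automorphism (@sym_polydisc R n) tau)
    (a beta : Cplx R) (a_disc : disc a) (beta_circle : circle beta)
    (tauE : is_tau (disc_aut a beta) tau) :
  let den : Cplx R := 1 + \sum_(1 <= l < n.+1) (-1) ^+ l * a^* ^+ l * coord1 s l in
  den != 0 /\
  forall i : nat, (1 <= i <= n)%N ->
    coord1 (tau s) i =
    beta ^+ i *
    ((\sum_(1 <= j < i)
        (- a) ^+ (i - j) *
        (\sum_(0 <= k < j.+1)
           'C(n - j, i - j + k)%:R * 'C(j, k)%:R * `|a| ^+ (2 * k)) * coord1 s j
      + \sum_(i <= j < n.+1)
        (- a^*) ^+ (j - i) *
        (\sum_(0 <= k < i.+1)
           'C(j, i - k)%:R * 'C(n - j, k)%:R * `|a| ^+ (2 * k)) * coord1 s j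
      + (-1) ^+ i * 'C(n, i)%:R * a ^+ i) / den).
Proof.
move=> den; case: s_Gamma @den => z z_disc <- den.
have z_neq0 l : 1 - a^* * z 0 l != 0 by exact: one_sub_conjM_neq0.
have denE : den = \prod_l (1 - a^* * z 0 l).
  under [RHS]eq_bigr do rewrite -mulNr.
  rewrite prod_addM_esym card_ord big_ord_recl !expr1n !mul1r esym0 /den.
  congr (_ + _); rewrite big_add1 big_mkord; apply: eq_bigr => l _.
  rewrite coord1_symmetrization; last by rewrite ltn_ord.
  by rewrite expr1n mul1r [in RHS]exprNn.
have den_neq0 : den != 0 by rewrite denE; apply/prodf_neq0 => l _.
split=> // i /andP[i_gt0 le_in].
rewrite tauE // coord1_symmetrization ?i_gt0 //.
transitivity (beta ^+ i *
    esym (fun l => (z 0 l - a) / (1 - a^* * z 0 l)) i).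
  by rewrite -esymZ; congr esym; apply/funext => l; rewrite mxE.
congr (_ * _); apply: (canRL (mulfK den_neq0)).
rewrite denE esym_moebius ?card_ord //.
have normE k : `|a| ^+ (2 * k) = (a * a^*) ^+ k by rewrite exprM normCK.
pose C j : Cplx R := \sum_(k < i.+1) (- a^*) ^+ (j - (i - k)) * (- a) ^+ k
        * ('C(j, i - k) * 'C(n - j, k))%:R.
rewrite -(big_mkord xpredT (fun j => C j * esym (z 0) j)).
rewrite (@big_cat_nat _ _ _ 1) //= big_nat1 esym0 mulr1 addrC.
rewrite (@big_cat_nat _ _ _ i) //=; last exact: leqW.
congr (_ + _ + _).
- apply: eq_big_nat => j /andP[j_gt0 lt_ji].
  rewrite coord1_symmetrization ?j_gt0 ?(leq_trans (ltnW lt_ji)) //.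
  by rewrite /C convolution_lt //; under [in RHS]eq_bigr do rewrite normE.
- apply: eq_big_nat => j /andP[le_ij le_jn].
  rewrite coord1_symmetrization ?(leq_trans i_gt0) //.
  by rewrite /C convolution_ge //; under [in RHS]eq_bigr do rewrite normE.
rewrite /C convolution_lt // big_nat1 !subn0 addn0 bin0 expr0 !mulr1.
by rewrite [(- a) ^+ i]exprNn mulrAC.
Qed.
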